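(* Let $(X,\mathbb{U})$ and $(Y,\mathbb{V})$ be two uniform spaces. Then $(X\times Y,\mathbb{U}\times\mathbb{V})$ is locally ${\sf H}$-bounded if and only if both $(X,\mathbb{U})$ and $(Y,\mathbb{V})$ are locally ${\sf H}$-bounded.
   Context: For a set $X$, an entourage of the diagonal $\Delta=\{(x,x):x\in X\}$ is a set $U\subseteq X\times X$ with $\Delta\subseteq U$ and $U^{-1}=U$, where $U^{-1}=\{(x,y):(y,x)\in U\}$. For $A,B\subseteq X\times X$, $A\circ B=\{(x,y):\exists z\in X \text{ such that } (x,z)\in A \text{ and } (z,y)\in B\}$. A uniformity on $X$ is a family $\mathbb{U}$ of entourages of the diagonal such that: (i) if $U\in\mathbb{U}$ and $V$ is an entourage of the diagonal with $U\subseteq V$, then $V\in\mathbb{U}$; (ii) $U,V\in\mathbb{U}$ implies $U\cap V\in\mathbb{U}$; (iii) for every $U\in\mathbb{U}$ there is $V\in\mathbb{U}$ with $V\circ V\subseteq U$; (iv) $\bigcap\mathbb{U}=\Delta$. The pair $(X,\mathbb{U})$ is called a uniform space. For $U\in\mathbb{U}$, $x\in X$, $F\subseteq X$: $U[x]=\{y\in X:(x,y)\in U\}$ and $U[F]=\bigcup_{x\in F}U[x]$. A subset $Y\subseteq X$ is regarded as a subspace with the relative uniformity $\mathbb{U}_Y=\{(Y\times Y)\cap U:U\in\mathbb{U}\}$. $\mathbb{U}\times\mathbb{V}$ denotes the usual product uniformity on $X\times Y$, with base the sets $\{((x,y),(x',y')):(x,x')\in U,\ (y,y')\in V\}$ for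 $U\in\mathbb{U}$, $V\in\mathbb{V}$. A uniform space $(X,\mathbb{U})$ is ${\sf H}$-bounded (Hurewicz-bounded) if for each sequence $(U_n)_{n\in\mathbb{N}}$ of members of $\mathbb{U}$ there is a sequence $(F_n)$ of finite subsets of $X$ such that each $x\in X$ belongs to $U_n[F_n]$ for all but finitely many $n$. It is locally ${\sf H}$-bounded if for each $x\in X$ there exists $U\in\mathbb{U}$ such that $U[x]$ is an ${\sf H}$-bounded subspace of $X$.
   Formalization: Both X and Y are assumed nonempty; without this the ''only if'' direction fails (X empty, Y not locally H-bounded: the product is empty and so vacuously locally H-bounded). *)

(* Defs.v *)
From HB Require Import structures.
From mathcomp Require Import all_boot all_order all_algebra.
From mathcomp Require Import all_classical all_reals all_analysis.

Set Implicit Arguments.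
Unset Strict Implicit.
Unset Printing Implicit Defensive.

Local Open Scope classical_set_scope.

(* In a [uniformType], [entourage] is the filter of all, not necessarily
   symmetric, entourages. A uniformity in the sense of Engelking consists of
   symmetric sets only: it is the family of symmetric members of that filter. *)
Definition uniformity (X : uniformType) : set_system (X * X) :=
  [set U | entourage U /\ (U^-1)%relation = U].

(* The axioms of [uniformType] do not include separation. *)
Definition separated_uniformity (X : uniformType) : Prop :=
  \bigcap_(U in @uniformity X) U = diagonal.

(* U[F]; note that U[x] is [xsection U x]. *)
Definition uball (X : uniformType) (U : set (X * X)) (F : set X) : set X :=
  \bigcup_(x in F) xsection U x.

Definition H_bounded (X : uniformType) : Prop :=
  forall U : nat -> set (X * X), (forall n, uniformity (U n)) ->
    exists F : nat -> set X, (forall n, finite_set (F n)) /\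
      forall x : X, \forall n \near \oo, uball (U n) (F n) x.

(* [set_type A] carries the relative uniformity, that is, the initial
   uniformity for the inclusion of A. *)
Definition locally_H_bounded (X : uniformType) : Prop :=
  forall x : X, exists U : set (X * X),
    uniformity U /\ H_bounded (set_type (xsection U x)).

(* Main.v *)
(* Call a subset [A] of [X] relatively H-bounded if the finite centres in the
   definition may be taken anywhere in [X].  Halving the entourages moves the
   centres into [A], so this is the same as H-boundedness of the subspace [A],
   but it is visibly inherited by subsets, uniformly continuous images and
   finite products. *)
Require Import Defs.
From mathcomp Require Import all_boot all_order all_algebra.
From mathcomp Require Import all_classical all_reals all_analysis.

Set Implicit Arguments.
Unset Strict Implicit.
Unset Printing Implicit Defensive.

Local Open Scope classical_set_scope.
Local Open Scope relation_scope.

Definition rel_H_bounded (X : uniformType) (A : set X) : Prop :=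
  forall U : nat -> set (X * X), (forall n, entourage (U n)) ->
    exists F : nat -> set X, (forall n, finite_set (F n)) /\
      forall x : X, A x -> \forall n \near \oo, uball (U n) (F n) x.

Lemma uniformity_invI (X : uniformType) (E : set (X * X)) :
  entourage E -> uniformity (E `&` E^-1).
Proof.
move=> entE; split; first exact: entourage_invI.
by rewrite predeqE => -[x y]; split=> -[].
Qed.

Lemma entourage_set_typeP (X : uniformType) (A : set X)
    (E : set (set_type A * set_type A)) :
  entourage E <-> exists2 V : set (X * X), entourage V &
    forall a b : set_type A, V (\val a, \val b) -> E (a, b).
Proof.
split=> -[V entV VE]; exists V => //; first by move=> a b; exact: (VE (a, b)).
by move=> [a b]; exact: VE.
Qed.

(** The product uniformity comes as a product filter on pairs from [X] together with pairs from [Y],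
    transported by exchanging the two middle coordinates. Both directions undo this exchange. *)
Lemma entourage_prodP (X Y : uniformType) (E : set ((X * Y) * (X * Y))) :
  entourage E <-> exists U V, [/\ entourage U, entourage V &
    forall p q, U (p.1, q.1) -> V (p.2, q.2) -> E (p, q)].
Proof.
split=> [[[U V] [entU entV] UVE]|[U [V [entU entV UVE]]]].
  exists U, V; split=> // -[x y] [x' y'] Uxx Vyy.
  have [[[? ?] [? ?]] ? [<- <- <- <-] //] :=
    UVE ((x, x'), (y, y')) (conj Uxx Vyy).
exists (U, V) => // -[[x x'] [y y']] [Uxx Vyy].
by exists ((x, y), (x', y')) => //; exact: UVE.
Qed.

Lemma H_boundedP (X : uniformType) (A : set X) :
  H_bounded (set_type A) <-> rel_H_bounded A.
Proof.
split=> bA U.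
  move=> entU.
  (* [H_bounded] accepts symmetric entourages only, so the trace of [U n] on [A] is symmetrised
     first. *)
  pose V n : set (set_type A * set_type A) :=
    [set p | (U n `&` (U n)^-1) (\val p.1, \val p.2)].
  have [n|F [finF FV]] := bA V.
    split; last by rewrite predeqE => -[a b]; split=> -[].
    apply/entourage_set_typeP; exists (U n `&` (U n)^-1) => //.
    exact: entourage_invI.
  exists (fun n => \val @` F n); split=> [n|x Ax]; first exact: finite_image.
  apply: filterS (FV (SigSub (mem_set Ax))) => n [a Fa /xsectionP[Uax _]].
  by exists (\val a); [exists a | apply/xsectionP].
move=> unifU.
have /choice[V VP] : forall n, exists V : set (X * X), entourage V /\
    forall a b : set_type A, V (\val a, \val b) -> U n (a, b).
  by move=> n; have [/entourage_set_typeP[V ? ?] _] := unifU n; exists V.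
have entV n : entourage (V n) by have [] := VP n.
(* Symmetry lets a centre [z] be replaced by a point [a] of [A]: if [a] and [b] are both [W n]-close
   to [z], the path from [a] through [z] to [b] lies in [V n]. *)
pose W n := split_ent (V n) `&` (split_ent (V n))^-1.
have [n|F [finF FW]] := bA W; first exact/entourage_invI/entourage_split_ent.
(* [G] replaces the centre [z] at stage [n] by one point of [A] close to it, or by the empty set
   when [z] is close to no point of [A] and so covers nothing there. *)
have /choice[G GP] : forall nz : nat * X, exists G : set (set_type A),
    finite_set G /\ forall b : set_type A, W nz.1 (nz.2, \val b) ->
    uball (U nz.1) G b.
  move=> [n z] /=.
  have [[a [_ Wza]]|noa] := pselect (exists a : set_type A, W n (z, \val a)).
    exists [set a]; split=> // b [Wzb _]; exists a => //; apply/xsectionP.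
    by apply: (VP n).2; exact: (entourage_split z).
  by exists set0; split=> // b Wzb; case: noa; exists b.
exists (fun n => \bigcup_(z in F n) G (n, z)); split=> [n|b].
  by apply: bigcup_finite => // z _; have [] := GP (n, z).
apply: filterS (FW _ (set_valP b)) => n [z Fz /xsectionP Wzb].
by have [_ /(_ b Wzb)[a Ga Uab]] := GP (n, z); exists a => //; exists z.
Qed.

Lemma sub_rel_H_bounded (X : uniformType) (A B : set X) :
  A `<=` B -> rel_H_bounded B -> rel_H_bounded A.
Proof.
move=> AB bB U /bB[F [finF FU]]; exists F; split=> // x /AB; exact: FU.
Qed.

Lemma rel_H_bounded_image (X Y : uniformType) (f : X -> Y) (A : set X) :
  unif_continuous f -> rel_H_bounded A -> rel_H_bounded (f @` A).
Proof.
move=> fc bA U entU.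
have [n|F [finF FU]] := bA (fun n => [set p | U n (f p.1, f p.2)]).
  exact: fc (entU n).
exists (fun n => f @` F n); split=> [n|_ [x Ax <-]]; first exact: finite_image.
apply: filterS (FU x Ax) => n [z Fz /xsectionP Uzx].
by exists (f z); [exists z | apply/xsectionP].
Qed.

Lemma rel_H_bounded_prod (X Y : uniformType) (A : set X) (B : set Y) :
  rel_H_bounded A -> rel_H_bounded B -> rel_H_bounded (A `*` B).
Proof.
move=> bA bB W entW.
have /choice[U UP] : forall n, exists U : set (X * X) * set (Y * Y),
    [/\ entourage U.1, entourage U.2 &
    forall p q, U.1 (p.1, q.1) -> U.2 (p.2, q.2) -> W n (p, q)].
  by move=> n; have /entourage_prodP[U [V ?]] := entW n; exists (U, V).
have [n|F [finF FU]] := bA (fun n => (U n).1); first by have [] := UP n.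
have [n|G [finG GU]] := bB (fun n => (U n).2); first by have [] := UP n.
exists (fun n => F n `*` G n); split=> [n|[x y] [/= Ax By]].
  exact: finite_setX.
apply: filterS2 (FU x Ax) (GU y By) => n.
move=> [u Fu /xsectionP Uux] [v Gv /xsectionP Vvy].
by exists (u, v) => //; apply/xsectionP; have [_ _] := UP n; exact.
Qed.

Lemma unif_continuous_fst (X Y : uniformType) :
  unif_continuous (fst : X * Y -> X).
Proof.
move=> U entU; apply/entourage_prodP; exists U, setT.
by split=> //; exact: entourageT.
Qed.

Lemma unif_continuous_snd (X Y : uniformType) :
  unif_continuous (snd : X * Y -> Y).
Proof.
move=> U entU; apply/entourage_prodP; exists setT, U.
by split=> //; exact: entourageT.
Qed.

(** Symmetrising an entourage only shrinks its sections, and relative H-boundedness passes to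
    subsets. *)
Lemma locally_H_boundedP (X : uniformType) :
  locally_H_bounded X <->
  forall x : X, exists2 U, entourage U & rel_H_bounded (xsection U x).
Proof.
split=> bX x; have [U] := bX x.
  by move=> [[entU _] /H_boundedP bU]; exists U.
move=> entU bU; exists (U `&` U^-1); split; first exact: uniformity_invI.
apply/H_boundedP; apply: sub_rel_H_bounded bU.
by move=> y /xsectionP[Uxy _]; apply/xsectionP.
Qed.

Theorem theorem4p7 (X Y : uniformType)
    (sepX : separated_uniformity X) (sepY : separated_uniformity Y)
    (X0 : ([set: X] !=set0)%classic) (Y0 : ([set: Y] !=set0)%classic) :
  locally_H_bounded (X * Y)%type <-> locally_H_bounded X /\ locally_H_bounded Y.
Proof.
rewrite !locally_H_boundedP; split=> [bXY|[bX bY] [x y]].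
  (* These base points embed each factor as a slice of the product; over an empty factor the product
     would say nothing about the other one. *)
  have [[x0 _] [y0 _]] := (X0, Y0).
  split=> [x|y].
    have [W /entourage_prodP[U [V [entU entV UVW]]] bW] := bXY (x, y0).
    exists U => //.
    (* [U[x]] lies in the first projection of [W[(x, y0)]]: a point [z] lifts to [(z, y0)], because
       [V] contains the diagonal. *)
    have := rel_H_bounded_image (@unif_continuous_fst X Y) bW.
    apply: sub_rel_H_bounded => z /xsectionP Uxz.
    exists (z, y0) => //; apply/xsectionP/UVW => //.
    exact: entourage_refl.
  have [W /entourage_prodP[U [V [entU entV UVW]]] bW] := bXY (x0, y).
  exists V => //.
  have := rel_H_bounded_image (@unif_continuous_snd X Y) bW.
  apply: sub_rel_H_bounded => z /xsectionP Vyz.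
  exists (x0, z) => //; apply/xsectionP/UVW => //.
  exact: entourage_refl.
have [U entU bU] := bX x; have [V entV bV] := bY y.
(* The section of this box at [(x, y)] is contained in the product of [U[x]] and [V[y]]. *)
exists [set pq | U (pq.1.1, pq.2.1) /\ V (pq.1.2, pq.2.2)].
  by apply/entourage_prodP; exists U, V.
apply: sub_rel_H_bounded (rel_H_bounded_prod bU bV) => -[u v].
by move=> /xsectionP[Uxu Vyv]; split; apply/xsectionP.
Qed.
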